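(* If $q\in\{9,10,\dots,15\}$, then $\operatorname{achr}(K_6\square K_q)\ge 2q+6$.
   Context: For a finite simple graph $G$, $\operatorname{achr}(G)$ (the achromatic number) is the maximum number of colours in a proper vertex colouring of $G$ that is complete, i.e. every pair of distinct colours appears on the two ends of some edge. $K_6\square K_q$ is the Cartesian product of the complete graphs $K_6$ and $K_q$ (vertex set $[1,6]\times[1,q]$, two vertices adjacent iff they agree in exactly one coordinate). *)

(* Defs.v *)
From mathcomp Require Import all_boot.

Set Implicit Arguments.
Unset Strict Implicit.
Unset Printing Implicit Defensive.

Record sgraph := SGraph {
  vertex :> finType;
  adj : rel vertex;
  adj_sym : symmetric adj;
  adj_irrefl : irreflexive adj }.

Section Coloring.
Variables (G : sgraph) (k : nat).
Implicit Type f : {ffun G -> 'I_k}.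

Definition proper_coloring f :=
  [forall u : G, forall v : G, adj u v ==> (f u != f v)].

Definition complete_coloring f :=
  [forall a : 'I_k, forall b : 'I_k, (a != b) ==>
    [exists u : G, exists v : G, [&& adj u v, f u == a & f v == b]]].

(* Completeness forces every colour to be used only when k >= 2. *)
Definition uses_all_colors f := [forall a : 'I_k, exists u : G, f u == a].

Definition has_complete_coloring :=
  [exists f : {ffun G -> 'I_k},
    [&& proper_coloring f, complete_coloring f & uses_all_colors f]].

End Coloring.

(* A colouring uses at most #|G| colours, so the bound on k loses nothing;
   see achr_max. *)
Definition achr (G : sgraph) : nat :=
  \max_(k < #|G|.+1 | has_complete_coloring G k) k.

Lemma has_complete_coloring_card (G : sgraph) k :
  has_complete_coloring G k -> k <= #|G|.
Proof.
case/existsP=> f /and3P[_ _ /forallP fs].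
have fs' (a : 'I_k) : a \in codom f.
  by case/existsP: (fs a) => u /eqP <-; apply: codom_f.
have: size (enum 'I_k) <= size (codom f).
  by apply: uniq_leq_size => [|a _]; [apply: enum_uniq | apply: fs'].
by rewrite size_enum_ord size_codom.
Qed.

Lemma achr_max (G : sgraph) k : has_complete_coloring G k -> k <= achr G.
Proof.
move=> hk; have lt_k : k < #|G|.+1 by rewrite ltnS has_complete_coloring_card.
exact: (@leq_bigmax_cond _ _ (fun i : 'I__ => i : nat) (Ordinal lt_k)).
Qed.

Definition complete_adj n : rel 'I_n := fun i j => i != j.

Lemma complete_adj_sym n : symmetric (@complete_adj n).
Proof. by move=> i j; rewrite /complete_adj eq_sym. Qed.

Lemma complete_adj_irrefl n : irreflexive (@complete_adj n).
Proof. by move=> i; rewrite /complete_adj eqxx. Qed.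

Definition complete_graph n : sgraph :=
  SGraph (@complete_adj_sym n) (@complete_adj_irrefl n).

Section CartesianProduct.
Variables G H : sgraph.

Definition cart_adj : rel (G * H)%type := fun u v =>
  (u.1 == v.1) && adj u.2 v.2 || adj u.1 v.1 && (u.2 == v.2).

Lemma cart_adj_sym : symmetric cart_adj.
Proof.
move=> u v; rewrite /cart_adj [u.1 == _]eq_sym [u.2 == _]eq_sym.
by rewrite [adj u.1 _]adj_sym [adj u.2 _]adj_sym.
Qed.

Lemma cart_adj_irrefl : irreflexive cart_adj.
Proof. by move=> u; rewrite /cart_adj !adj_irrefl andbF. Qed.

Definition cart_prod : sgraph := SGraph cart_adj_sym cart_adj_irrefl.

End CartesianProduct.

Lemma adj_cart_complete p q
    (u v : cart_prod (complete_graph p) (complete_graph q)) :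
  adj u v = (u.1 == v.1) (+) (u.2 == v.2).
Proof.
rewrite /adj /= /cart_adj /= /complete_adj.
by case: (u.1 == v.1); case: (u.2 == v.2).
Qed.

(* Main.v *)
Require Import Defs.
From mathcomp Require Import all_boot.

(** Split the six rows into the halves {0,1,2} and {3,4,5}.  Use 18 colours of
    frequency 2, two for each pair (row of the top half, row of the bottom
    half), and 2 (q - 6) colours of frequency 3, half of them on the top rows
    and half on the bottom rows.  A colour of frequency 3 then shares a row
    with every other colour except those of frequency 3 in the opposite half.

    The 18 colours fill six columns, indexed by the permutations s of S_3: the
    column of s contains both colours of the pair (i, j) when s i = j, placed
    according to the sign of s.  Two pairs differing in both coordinates lie in
    the graph of a common s, whose column contains all four of their colours;
    two pairs sharing a coordinate share a row.

    The other n = q - 6 columns form two circulants mod n.  A top colour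
    occupies three consecutive columns, a bottom colour three columns with
    cyclic gaps at most 3, which is possible because 3 <= n <= 9; so a top and a
    bottom colour always share a column. *)

Definition cells p q : seq (nat * nat) :=
  [seq (i, j) | i <- iota 0 p, j <- iota 0 q].

Definition cell_adj (u v : nat * nat) := (u.1 == v.1) (+) (u.2 == v.2).

(** Boolean tests over lists of naturals, so that evaluation decides them. Listing the cells [s] of
    colour [a] once keeps each search for an edge to colour [b] short; [s != [::]] provides
    [uses_all_colors]. *)
Definition complete_array p q k (c : nat * nat -> nat) :=
  [&& all (fun u => c u < k) (cells p q),
      all (fun u => all (fun v => cell_adj u v ==> (c u != c v)) (cells p q))
          (cells p q)
    & all (fun a =>
        let s := [seq u <- cells p q | c u == a] in
        (s != [::]) &&
        all (fun b => (a != b) ==>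
              has (fun u => has (fun v => cell_adj u v && (c v == b))
                                (cells p q)) s)
            (iota 0 k))
      (iota 0 k)].

Lemma mem_cells p q i j : ((i, j) \in cells p q) = (i < p) && (j < q).
Proof.
apply/allpairsP/andP=> [[[x y] /= []]|[ip jq]].
  by rewrite !mem_iota => xp yq [-> ->].
by exists (i, j); rewrite !mem_iota.
Qed.

Lemma complete_array_achr p q k c :
  complete_array p q k c ->
  k <= achr (cart_prod (complete_graph p) (complete_graph q)).
Proof.
case/and3P=> /allP ck /allP proper_c /allP complete_c; apply: achr_max.
pose G := cart_prod (complete_graph p) (complete_graph q).
pose cell (u : G) : nat * nat := (val u.1, val u.2).
have cellP u : cell u \in cells p q by rewrite mem_cells !ltn_ord.
have cell_inv x : x \in cells p q -> exists u, cell u = x.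
  case: x => i j; rewrite mem_cells => /andP[ip jq].
  by exists (Ordinal ip, Ordinal jq).
have adjE u v : adj u v = cell_adj (cell u) (cell v).
  by rewrite adj_cart_complete.
have colorP (a : 'I_k) := complete_c a; rewrite /= in colorP.
apply/existsP; exists [ffun u : G => Ordinal (ck _ (cellP u))].
apply/and3P; split.
- apply/forallP=> u; apply/forallP=> v; apply/implyP; rewrite adjE !ffunE => uv.
  by have /allP/(_ _ (cellP v))/implyP/(_ uv) := proper_c _ (cellP u).
- apply/forallP=> a; apply/forallP=> b; apply/implyP=> ab.
  have := colorP a; rewrite mem_iota ltn_ord => /(_ isT)/andP[_ /allP/(_ b)].
  rewrite mem_iota ltn_ord => /(_ isT)/implyP/(_ ab)/hasP[x].
  rewrite mem_filter => /andP[cx /cell_inv[u ux]] /hasP[y /cell_inv[v vy]].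
  case/andP=> xy cy; apply/existsP; exists u; apply/existsP; exists v.
  by rewrite adjE !ffunE -!val_eqE /= ux vy xy cx.
- apply/forallP=> a; have := colorP a; rewrite mem_iota ltn_ord => /(_ isT).
  case/andP; rewrite -has_filter => /hasP[x /cell_inv[u <-] cx] _.
  by apply/existsP; exists u; rewrite ffunE -val_eqE.
Qed.

(* Colours below 18 code triples (i, j, e) as 9 e + 3 i + j.  Columns 0, 1, 2
   are the even permutations i |-> i + y, columns 3, 4, 5 the odd ones
   i |-> y - i, both mod 3. *)
Definition array6 q (u : nat * nat) : nat :=
  let: (x, y) := u in
  let n := q - 6 in
  let r := x %% 3 in
  if y < 3 then
    if x < 3 then 3 * r + (r + y) %% 3 else 9 + 3 * ((r + 3 - y) %% 3) + r
  else if y < 6 then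
    if x < 3 then 9 + 3 * r + (y - r) %% 3 else 3 * ((y - r) %% 3) + r
  else if x < 3 then 18 + (y - 6 + r) %% n
  else 18 + n + (y - 6 + (n * r) %/ 3) %% n.

Lemma array6_complete q :
  9 <= q <= 15 -> complete_array 6 q (2 * q + 6) (array6 q).
Proof.
(* Membership in the explicit list 9, ..., 15 turns the claim into one closed [all], so the seven
   arrays are checked by evaluation. *)
move=> hq; have {hq}: q \in iota 9 7 by rewrite mem_iota.
by move: q; apply/allP; vm_compute.
Qed.

Theorem proposition6 (q : nat) (hq : 9 <= q <= 15) :
  2 * q + 6 <= achr (cart_prod (complete_graph 6) (complete_graph q)).
Proof.
exact: complete_array_achr (array6_complete q hq).
Qed.
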